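(* Assume $E X_1<\infty$ and fix $\epsilon\in(0,\mu)$. For the $s$-th system define $$\kappa(V)=\inf\{k\ge 1: V_{n+1}\le n(\mu-\epsilon)/s \ \text{for all } n\ge k\},\qquad \kappa(A)=\inf\{k\ge1: |A_{n+1}|\ge n(\mu-\epsilon)/s\ \text{for all } n\ge k\},$$ and $\kappa=\max\{\kappa(V),\kappa(A)\}$. Then, as $s\to\infty$: (1) if $E V_1^{q}<\infty$ for some $q>2$, then $E_\pi^s\kappa=O(s^{q/(q-1)})$; (2) if moreover $E\exp(\theta V_1)<\infty$ for some $\theta>0$, then $E_\pi^s\kappa=O(s\log s)$.
   Context: Let $(X_n)_{n\ge1}$ be i.i.d. strictly positive random variables with mean $\mu=EX_1\in(0,\infty)$, and $(V_n)_{n\ge1}$ i.i.d. nonnegative random variables independent of $(X_n)$. For a scale parameter $s\in\{1,2,\dots\}$, the $s$-th system is the time-stationary GI/GI/$\infty$ queue whose arrival epochs form a time-stationary renewal process on $\mathbb R$ with interarrival times distributed as $X_1/s$; service times are not scaled. The arrival epochs in $(-\infty,0]$, counted backwards from $0$, are $0\ge A_1>A_2>\cdots$ with $A_n-A_{n+1}=X_n/s$ (and $|A_1|$ having the stationary-excess distribution of $X_1/s$, independent of $(X_n)$); the $n$-th customer has service requirement $V_n$, starts service immediately at $A_n$ and departs at $A_n+V_n$. $E_\pi^s$ denotes expectation for this stationary $s$-th system. $\inf\emptyset=\infty$. *)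

(* Defs.v *)
From HB Require Import structures.
From mathcomp Require Import all_boot all_order all_algebra.
From mathcomp Require Import all_classical all_reals all_analysis.
Set Implicit Arguments. Unset Strict Implicit. Unset Printing Implicit Defensive.
Import Order.TTheory GRing.Theory Num.Theory.
Import numFieldNormedType.Exports.
Local Open Scope classical_set_scope.
Local Open Scope ring_scope.

(* Index set for the family of all primitive random variables:
   inl (inl n) = X_{n+1}, inl (inr n) = V_{n+1}, inr tt = |A_1| (time-zero residual). *)
Definition rv_index := ((nat + nat) + unit)%type.

Definition mutually_independent d (T : measurableType d) (R : realType)
  (P : probability T R) (I : eqType) (Y : I -> T -> R) : Prop :=
  forall (J : seq I) (B : I -> set R), uniq J ->
    (forall i, i \in J -> measurable (B i)) ->
    P (\big[setI/setT]_(i <- J) (Y i @^-1` B i)) =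
    (\prod_(i <- J) P (Y i @^-1` B i))%E.

Definition identically_distributed d (T : measurableType d) (R : realType)
  (P : probability T R) (Y : nat -> T -> R) : Prop :=
  forall n (B : set R), measurable B -> P (Y n @^-1` B) = P (Y 0%N @^-1` B).

(* Arrival epochs of the s-th system, 0-based shift:
   arrival s U X n = A_{n+1} = -( |A_1| + (X_1+...+X_n)/s ) where |A_1| = U/s
   and X_{i+1} = X i. *)
Definition arrival d (T : measurableType d) (R : realType) (s : nat)
  (U : T -> R) (X : nat -> T -> R) (n : nat) (w : T) : R :=
  - ((U w + \sum_(i < n) X i w) / s%:R).

(* kappa(V) for the s-th system (V_{n+1} = V n). inf over empty set = +oo. *)
Definition kappaV d (T : measurableType d) (R : realType) (mu eps : R) (s : nat)
  (V : nat -> T -> R) (w : T) : \bar R :=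
  ereal_inf [set (k%:R)%:E | k in [set k : nat | (1 <= k)%N /\
     forall n : nat, (k <= n)%N -> V n w <= n%:R * (mu - eps) / s%:R]].

(* kappa(A) for the s-th system (A_{n+1} = arrival s U X n). *)
Definition kappaA d (T : measurableType d) (R : realType) (mu eps : R) (s : nat)
  (U : T -> R) (X : nat -> T -> R) (w : T) : \bar R :=
  ereal_inf [set (k%:R)%:E | k in [set k : nat | (1 <= k)%N /\
     forall n : nat, (k <= n)%N ->
       n%:R * (mu - eps) / s%:R <= `|arrival s U X n w| ]].

Definition kappa d (T : measurableType d) (R : realType) (mu eps : R) (s : nat)
  (U : T -> R) (X V : nat -> T -> R) (w : T) : \bar R :=
  maxe (kappaV mu eps s V w) (kappaA mu eps s U X w).

Definition stationary_excess d (T : measurableType d) (R : realType)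
  (P : probability T R) (mu : R) (X1 U : T -> R) : Prop :=
  forall x : R, 0 <= x ->
    (mu%:E * P [set w | (U w <= x)%R] =
     \int[lebesgue_measure]_(y in `[0%R, x]%classic) P [set w | (y < X1 w)%R])%E.

(* Main.v *)
(* With bad events B_n, the last bad index satisfies, for every cutoff K,
     kappa <= K + 1 + sum_(n >= K) (n + 1) 1_(B_n),
   so E kappa is at most K + 1 plus a weighted tail of P(B_n).
   For kappa(A) the scale s cancels: B_n = {U + S_n < n (mu - eps)}, where
   S_n = X_1 + ... + X_n and U >= 0 almost surely. A Chernoff bound (valid for
   the lower tail of positive variables under a first moment only) gives
   P(B_n) <= rho^n with rho < 1, hence a bound uniform in s with K = 0.
   For kappa(V), Markov's inequality gives P(B_n) = O((s / n)^q), respectively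
   O(exp(- theta n (mu - eps) / s)); the cutoff K of order s^(q / (q - 1)),
   respectively s log s, balances the two terms. *)
Require Import Defs.
From HB Require Import structures.
From mathcomp Require Import all_boot all_order all_algebra.
From mathcomp Require Import all_classical all_reals all_analysis.
From mathcomp Require Import finmap measurable_realfun.
From mathcomp Require Import ring lra.
Set Implicit Arguments. Unset Strict Implicit. Unset Printing Implicit Defensive.
Import Order.TTheory GRing.Theory Num.Theory.
Import numFieldNormedType.Exports.
Local Open Scope classical_set_scope.
Local Open Scope ring_scope.

(** * Integral comparison and weighted sums of indicators *)

Section integral_bounds.
Context d (T : measurableType d) (R : realType) (mu : {measure set T -> \bar R}).
Local Open Scope ereal_scope.

(* Unlike [ge0_le_integral], no measurability is required. *)
Lemma ge0_le_integral_sup (f g : T -> \bar R) :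
  (forall w, 0 <= f w) -> (forall w, f w <= g w) ->
  \int[mu]_w f w <= \int[mu]_w g w.
Proof.
move=> f0 fg; rewrite !ge0_integralTE//; last first.
  by move=> w; exact: le_trans (f0 w) (fg w).
apply: ereal_sup_le => _ [h /= hf <-]; exists h => // w.
exact: le_trans (hf w) (fg w).
Qed.

(** The function [h] dominates the indicator of [A]; both the Chernoff and the Markov bounds below
    are instances. *)
Lemma measure_le_integral (A : set T) (h : T -> R) : measurable A ->
  measurable_fun setT h -> (forall w, (0 <= h w)%R) ->
  (forall w, A w -> (1 <= h w)%R) -> mu A <= \int[mu]_w (h w)%:E.
Proof.
move=> mA mh h0 h1.
rewrite -[A in mu A]setIT -(integral_indic mu measurableT mA).
apply: ge0_le_integral_sup => w; rewrite lee_fin// indicE.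
by have [/set_mem/h1|_] := boolP (w \in A).
Qed.

Lemma nneseries_integral_indicM (B : (set T)^nat) (c : nat -> R) :
  (forall n, measurable (B n)) -> (forall n, (0 <= c n)%R) ->
  \int[mu]_w (\sum_(n <oo) (c n * \1_(B n) w)%:E) =
  \sum_(n <oo) (c n)%:E * mu (B n).
Proof.
move=> mB c0; rewrite integral_nneseries//; last 2 first.
- move=> n; apply/measurable_EFinP; exact: measurable_funM.
- by move=> n w _; rewrite lee_fin mulr_ge0.
apply: eq_eseriesr => n _; under eq_integral do rewrite EFinM.
rewrite ge0_integralZl ?lee_fin//.
  by rewrite integral_indic// setIT.
exact/measurable_EFinP.
Qed.

End integral_bounds.

(** * Factorisation of integrals: from events to nonnegative functions *)

Section independence.
Context d (T : measurableType d) (R : realType) (mu : {measure set T -> \bar R}).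
Local Open Scope ereal_scope.
Import HBNNSimple.

Lemma integral_sum_indicM (h : T -> R) (N : nat) (a : 'I_N -> R)
    (B : 'I_N -> set T) :
  measurable_fun setT h -> (forall w, (0 <= h w)%R) ->
  (forall i, (0 <= a i)%R) -> (forall i, measurable (B i)) ->
  \int[mu]_w (h w * \sum_(i < N) a i * \1_(B i) w)%:E =
  \sum_(i < N) (a i)%:E * \int[mu]_w (h w * \1_(B i) w)%:E.
Proof.
move=> mh h0 a0 mB.
have mhB i : measurable_fun setT (fun w => (h w * \1_(B i) w)%:E).
  by apply/measurable_EFinP; exact: measurable_funM.
have hB0 i w : 0 <= (h w * \1_(B i) w)%:E by rewrite lee_fin mulr_ge0.
transitivity (\int[mu]_w \sum_(i < N) (a i)%:E * (h w * \1_(B i) w)%:E).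
  apply: eq_integral => w _; rewrite mulr_sumr -sumEFin.
  by apply: eq_bigr => i _; rewrite -EFinM mulrCA.
rewrite ge0_integral_sum//; last 2 first.
- by move=> i; apply: measurable_funeM.
- by move=> i w _; rewrite mule_ge0// lee_fin.
apply: eq_bigr => i _; rewrite ge0_integralZl// lee_fin.
exact: a0.
Qed.

(** The factorisation assumed on events of [Y] extends to simple functions by linearity, then to [g]
    by monotone convergence. Under a probability, [B := setT] shows that [c] is the integral of
    [h]. *)
Lemma integral_factor (h : T -> R) (Y : T -> R) (c : \bar R) (g : R -> R) :
  measurable_fun setT h -> (forall w, (0 <= h w)%R) ->
  measurable_fun setT Y ->
  (forall B, measurable B ->
     \int[mu]_w (h w * \1_(Y @^-1` B) w)%:E = c * mu (Y @^-1` B)) ->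
  measurable_fun setT g -> (forall x, (0 <= g x)%R) -> c \is a fin_num ->
  \int[mu]_w (h w * g (Y w))%:E = c * \int[mu]_w (g (Y w))%:E.
Proof.
move=> mh h0 mY hY mg g0 cfin.
have mYB B : measurable B -> measurable (Y @^-1` B).
  by move=> mB; rewrite -[_ @^-1` _]setTI; exact: mY.
have mEg : measurable_fun setT (EFin \o g) by exact/measurable_EFinP.
pose G := nnsfun_approx measurableT mEg.
have mGY n : measurable_fun setT (G n \o Y) by exact: measurableT_comp.
have ndG x m n : (m <= n)%N -> (G m x <= G n x)%R.
  by move=> mn; exact/lefP/nd_nnsfun_approx.
have Gcvg x : EFin \o (fun n => G n x) @ \oo --> (g x)%:E.
  by apply: cvg_nnsfun_approx => // y _; rewrite lee_fin.
(* Stated for a general [h'] because both sides need it: with [h] on the left and with the constant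
   1 on the right. *)
have hGcvg (h' : T -> R) : measurable_fun setT h' -> (forall w, (0 <= h' w)%R) ->
    (fun n => \int[mu]_w (h' w * G n (Y w))%:E) @ \oo -->
    \int[mu]_w (h' w * g (Y w))%:E.
  move=> mh' h'0.
  rewrite (_ : (fun w => (h' w * g (Y w))%:E) =
      (fun w => limn (fun n => (h' w * G n (Y w))%:E))); last first.
    apply/funext => w; apply/esym/cvg_lim => //.
    under eq_fun do rewrite EFinM.
    by rewrite EFinM; exact: cvgeZl (Gcvg _).
  apply: cvg_monotone_convergence => //.
  - move=> n; apply/measurable_EFinP. apply: measurable_funM => //; exact: mGY.
  - by move=> n w _; rewrite lee_fin mulr_ge0.
  - by move=> w _ m n mn; rewrite lee_fin ler_wpM2l// ndG.
have key n : \int[mu]_w (h w * G n (Y w))%:E =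
    c * \int[mu]_w (1 * G n (Y w))%:E.
  pose s := finmap.enum_fset (fset_set (range (G n))).
  have s0 i : (0 <= s`_i)%R.
    have [si|?] := ltnP i (size s); last by rewrite nth_default.
    have : s`_i \in fset_set (range (G n)) by exact: mem_nth.
    rewrite in_fset_set//.
    by move=> /set_mem[x _ <-].
  have GE w : G n (Y w) = (\sum_(i < size s)
      (s`_i * \1_(Y @^-1` (G n @^-1` [set s`_i])) w))%R by rewrite fimfunEord.
  have mB i : measurable (Y @^-1` (G n @^-1` [set s`_i])) by exact: mYB.
  under eq_integral do rewrite GE.
  under [in RHS]eq_integral do rewrite GE.
  rewrite !integral_sum_indicM//.
  rewrite ge0_sume_distrr; last first.
    move=> i _; rewrite mule_ge0 ?lee_fin//.
    by apply: integral_ge0 => w _; rewrite lee_fin mulr_ge0.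
  apply: eq_bigr => i _; rewrite muleCA hY//.
  congr (_ * (_ * _)).
  under eq_integral do rewrite mul1r.
  by rewrite integral_indic// setIT.
have := hGcvg _ mh h0.
under eq_fun do rewrite key.
move/cvg_lim => <-//; apply/cvg_lim => //; apply: cvgeZl => //.
have := hGcvg (cst 1%R) (measurable_cst _) (fun _ => ler01).
by under [in X in X -> _]eq_integral do rewrite mul1r.
Qed.
End independence.

(** * Expectation of a product of independent variables *)

Section expectation_prod.
Context d (T : measurableType d) (R : realType) (P : probability T R).
Local Open Scope ereal_scope.

Lemma mutually_independent_cons (I : eqType) (Y : I -> T -> R) (i : I)
    (J : seq I) (B : I -> set R) :
  mutually_independent P Y -> uniq (i :: J) ->
  (forall j, j \in i :: J -> measurable (B j)) ->
  P (Y i @^-1` B i `&` \big[setI/setT]_(j <- J) (Y j @^-1` B j)) =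
  P (Y i @^-1` B i) * P (\big[setI/setT]_(j <- J) (Y j @^-1` B j)).
Proof.
move=> indY uJ mB; have := indY _ _ uJ mB; rewrite !big_cons => ->.
move: uJ => /= /andP[_ uJ]; congr (_ * _); rewrite indY// => j jJ.
by apply: mB; rewrite inE jJ orbT.
Qed.

(** Strengthening that makes induction on [m] work: peeling off the factor of index [m] through
    [integral_factor] turns it into an event, which joins the intersection over [J]. Indices in [J]
    stay at or above [m], so they never meet the remaining factors. *)
Lemma expectation_prod_indic (Y : nat -> T -> R) (g : R -> R) (m : nat)
    (J : seq nat) (B : nat -> set R) :
  (forall n, measurable_fun setT (Y n)) -> mutually_independent P Y ->
  measurable_fun setT g -> (forall x, (0 <= g x)%R) ->
  (forall n, \int[P]_w (g (Y n w))%:E \is a fin_num) ->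
  uniq J -> (forall j, j \in J -> (m <= j)%N) ->
  (forall j, j \in J -> measurable (B j)) ->
  \int[P]_w ((\prod_(i < m) g (Y i w)) *
             \1_(\big[setI/setT]_(j <- J) (Y j @^-1` B j)) w)%:E =
  (\prod_(i < m) \int[P]_w (g (Y i w))%:E) *
    P (\big[setI/setT]_(j <- J) (Y j @^-1` B j)).
Proof.
move=> mY indY mg g0 gfin.
have mYB n (C : set R) : measurable C -> measurable (Y n @^-1` C).
  by move=> mC; rewrite -[_ @^-1` _]setTI; exact: mY.
have mcap (K : seq nat) (C : nat -> set R) :
    (forall j, j \in K -> measurable (C j)) ->
    measurable (\big[setI/setT]_(j <- K) (Y j @^-1` C j)).
  elim: K => [|k K IH] mC; first by rewrite big_nil.
  rewrite big_cons; apply: measurableI; first by apply: mYB; apply: mC; exact: mem_head.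
  by apply: IH => j jK; apply: mC; rewrite inE jK orbT.
elim: m J B => [|m IH] J B uJ mJ mB.
  rewrite big_ord0 mul1e; under eq_integral do rewrite big_ord0 mul1r.
  by rewrite integral_indic ?setIT//; exact: mcap.
set A := \big[setI/setT]_(j <- J) _.
have mA : measurable A by exact: mcap.
under eq_integral do rewrite big_ord_recr/= mulrAC.
pose h w := ((\prod_(i < m) g (Y i w)) * \1_A w)%R.
rewrite (integral_factor (h := h)
  (c := (\prod_(i < m) \int[P]_w (g (Y i w))%:E) * P A))//.
- by rewrite big_ord_recr/= muleAC.
- apply: measurable_funM => //; apply: measurable_prod => i _.
  exact: measurableT_comp.
- by move=> w; rewrite mulr_ge0// prodr_ge0.
- move=> C mC.
  (* Since [m] is not in [J], redefining [B] at [m] leaves [A] unchanged, and the induction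
     hypothesis applies to [m :: J]. *)
  pose B' i := if i == m then C else B i.
  have mJn : m \notin J by apply/negP => /mJ; rewrite ltnn.
  have BB' : A = \big[setI/setT]_(j <- J) (Y j @^-1` B' j).
    apply: eq_big_seq => j jJ; rewrite /B'; case: eqP => // jm.
    by rewrite -jm jJ in mJn.
  have mB' j : j \in m :: J -> measurable (B' j).
    rewrite inE /B'; case: eqP => //= _; exact: mB.
  have CB' : C = B' m by rewrite /B' eqxx.
  under eq_integral do rewrite /h -mulrA -[(_ * \1_(_ @^-1` C) _)%R]/((\1_A \* \1_(Y m @^-1` C)) _)%R -indicI setIC.
  rewrite {1}BB' {1}CB' -(big_cons setT setI m J xpredT (fun j => Y j @^-1` B' j)).
  rewrite IH//=; last 2 first.
  + by rewrite mJn.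
  + by move=> j; rewrite inE => /predU1P[->//|/mJ/ltnW].
  rewrite big_cons mutually_independent_cons//=; last by rewrite mJn.
  by rewrite -BB' -CB' -muleA [P A * _]muleC.
- rewrite fin_numM ?fin_num_measure//.
  by apply: prode_fin_num => i _; exact: gfin.
Qed.

Lemma expectation_prod (Y : nat -> T -> R) (g : R -> R) (m : nat) :
  (forall n, measurable_fun setT (Y n)) -> mutually_independent P Y ->
  measurable_fun setT g -> (forall x, (0 <= g x)%R) ->
  (forall n, \int[P]_w (g (Y n w))%:E \is a fin_num) ->
  \int[P]_w (\prod_(i < m) g (Y i w))%:E =
  \prod_(i < m) \int[P]_w (g (Y i w))%:E.
Proof.
move=> mY indY mg g0 gfin.
have := @expectation_prod_indic Y g m [::] (fun=> setT) mY indY mg g0 gfin.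
rewrite big_nil probability_setT mule1 => <-//.
by apply: eq_integral => w _; rewrite indicT mulr1.
Qed.

(** Both sides are integrals of [g] against push-forward laws that agree on measurable sets. *)
Lemma identically_distributed_integral (Y : nat -> T -> R) (g : R -> R) n :
  (forall n, measurable_fun setT (Y n)) -> identically_distributed P Y ->
  measurable_fun setT g -> (forall x, (0 <= g x)%R) ->
  \int[P]_w (g (Y n w))%:E = \int[P]_w (g (Y 0%N w))%:E.
Proof.
move=> mY idY mg g0.
have push k : \int[P]_w (g (Y k w))%:E = \int[pushforward P (Y k)]_x (g x)%:E.
  rewrite ge0_integral_pushforward//; first exact/measurable_EFinP.
  by move=> x _; rewrite lee_fin.
rewrite !push; apply: eq_measure_integral => A mA _.
exact: idY.
Qed.

End expectation_prod.

(** * Chernoff factor for the lower tail *)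

Section lower_tail.
Context d (T : measurableType d) (R : realType) (P : probability T R).
Local Open Scope ereal_scope.
Import HBNNSimple.

(** Multiply by [expR y >= 1 + y] and use [(1 + y)(1 - y + y^2) = 1 + y^3 >= 1]. *)
Lemma expRN_le (y : R) : (0 <= y)%R -> (expR (- y) <= 1 - y + y ^+ 2)%R.
Proof.
move=> y0; have e := expR_ge1Dx y; have e1 : (0 < expR y)%R by exact: expR_gt0.
rewrite expRN -(ler_pM2l e1) divff ?gt_eqF//.
apply: (@le_trans _ _ ((1 + y) * (1 - y + y ^+ 2))%R).
  have -> : ((1 + y) * (1 - y + y ^+ 2) = 1 + y ^+ 3)%R by ring.
  by rewrite lerDl exprn_ge0.
by rewrite ler_wpM2r//; nra.
Qed.

(** Some simple function [phi <= Z] still has integral [a > b]. It is bounded by some [M], so the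
    second-order bound on [expR (- t * phi)] can be integrated with only a first-moment condition on
    [Z], and [expR (- t * Z)] lies below it. *)
Lemma lower_mgf_lt1 (Z : T -> R) (b : R) :
  measurable_fun setT Z -> (forall w, (0 <= Z w)%R) ->
  b%:E < \int[P]_w (Z w)%:E ->
  exists t rho : R, [/\ (0 < t)%R, (0 <= rho < 1)%R &
    \int[P]_w (expR (t * (b - Z w)))%:E = rho%:E].
Proof.
move=> mZ Z0; rewrite ge0_integralTE; last by move=> w; rewrite lee_fin.
move=> /ereal_sup_gt[_ [phi /= phiZ <-]] bphi.
have [M [M0 phiM]] : exists M : R, (0 < M)%R /\ forall w, (phi w <= M)%R.
  have [M [_ /= phiM]] := simple_bounded phi.
  exists (`|M| + 1)%R; split; first exact: ltr_wpDl.
  move=> w; apply: le_trans (ler_norm _) _; apply: phiM => //.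
  by rewrite ltr_pwDr// ler_norm.
have {}bphi : b%:E < \int[P]_w (phi w)%:E.
  by rewrite integral_nnsfun// patch_setT.
have mphi : measurable_fun setT (fun w => (phi w)%:E) by exact/measurable_EFinP.
have phifin : \int[P]_w (phi w)%:E \is a fin_num.
  rewrite ge0_fin_numE; last by apply: integral_ge0 => w _; rewrite lee_fin.
  apply: (@le_lt_trans _ _ (\int[P]_w (cst M%:E w))).
    by apply: ge0_le_integral_sup => w; rewrite lee_fin.
  by rewrite integral_cst// [X in _ * X]probability_setT mule1 ltry.
move: bphi; rewrite -(fineK phifin) lte_fin; set a := fine _ => ba.
(* Minimiser of [t^2 M^2 - t (a - b)]; there [t^2 M^2 = t (a - b) / 2], whence
   [E0 < 1 - t b <= expR (- t b)]. *)
pose t := ((a - b) / (2 * M ^+ 2))%R.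
have M20 : (0 < M ^+ 2)%R by rewrite exprn_gt0.
have t0 : (0 < t)%R by rewrite divr_gt0 ?mulr_gt0// subr_gt0.
have mE (s : R) : measurable_fun setT (fun w => (expR (s - t * Z w))%:E).
  apply/measurable_EFinP; apply: measurableT_comp => //.
  by apply: measurable_funB => //; exact: measurable_funM.
pose E0 := \int[P]_w (expR (0 - t * Z w))%:E.
have E00 : 0 <= E0 by apply: integral_ge0 => w _; rewrite lee_fin expR_ge0.
(* Written as a sum to avoid subtraction in the extended reals: finiteness of [E0] is deduced from
   this very bound. *)
have E0a : E0 + (t * a)%:E <= (1 + t ^+ 2 * M ^+ 2)%:E.
  rewrite EFinM fineK// -ge0_integralZl//; last 2 first.
  - by move=> w _; rewrite lee_fin.
  - by rewrite lee_fin ltW.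
  rewrite -ge0_integralD//; last 2 first.
  - by move=> w _; rewrite mule_ge0 ?lee_fin// ltW.
  - exact: measurable_funeM.
  apply: (@le_trans _ _ (\int[P]_w (cst (1 + t ^+ 2 * M ^+ 2)%:E w))); last first.
    by rewrite integral_cst// [X in _ * X]probability_setT mule1.
  apply: ge0_le_integral_sup => w.
    by rewrite adde_ge0 ?mule_ge0 ?lee_fin ?expR_ge0// ltW.
  rewrite /= -EFinM -EFinD lee_fin sub0r.
  have phi0 : (0 <= phi w)%R by [].
  have := @expRN_le (t * phi w) (mulr_ge0 (ltW t0) phi0).
  have : (expR (- (t * Z w)) <= expR (- (t * phi w)))%R.
    by rewrite ler_expR lerN2 ler_wpM2l ?(ltW t0)// -lee_fin.
  have : ((t * phi w) ^+ 2 <= t ^+ 2 * M ^+ 2)%R.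
    by rewrite exprMn ler_wpM2l ?sqr_ge0// lerXn2r ?nnegrE// ltW.
  lra.
have E0fin : E0 \is a fin_num.
  rewrite ge0_fin_numE//; apply: le_lt_trans (ltry (1 + t ^+ 2 * M ^+ 2)%R).
  apply: le_trans E0a; rewrite leeDl// lee_fin.
  by rewrite mulr_ge0 ?(ltW t0)// fine_ge0// integral_ge0// => w _; rewrite lee_fin.
exists t, (expR (t * b) * fine E0)%R; split => //.
  rewrite mulr_ge0 ?expR_ge0 ?fine_ge0//=.
  move: E0a; rewrite -(fineK E0fin) -EFinD lee_fin => E0a.
  have t2 : (t ^+ 2 * M ^+ 2 = t * (a - b) / 2)%R.
    by rewrite /t; field; rewrite gt_eqF.
  have lt1 : (fine E0 < expR (- (t * b)))%R.
    apply: lt_le_trans (expR_ge1Dx _).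
    have : (0 < t * (a - b))%R by rewrite mulr_gt0// subr_gt0.
    by move: E0a; rewrite t2 mulrBr; lra.
  by rewrite -ltr_pdivlMl ?expR_gt0// mulr1 -expRN.
rewrite EFinM fineK// -ge0_integralZl ?lee_fin ?expR_ge0//.
apply: eq_integral => w _; rewrite -EFinM -expRD; congr (expR _)%:E; ring.
Qed.
End lower_tail.

(** * Last bad index and weighted tail sums *)

Section last_exceedance.
Context d (T : measurableType d) (R : realType) (P : probability T R).
Local Open Scope ereal_scope.

(** If [n >= 1] is the last bad index, the first admissible [k] is [n.+1]. The cutoff is encoded by
    zero weights, so every series starts at 0. *)
Definition tail_weight (K n : nat) : R := if (K <= n)%N then n.+1%:R else 0%R.

Lemma tail_weight_ge0 K n : (0 <= tail_weight K n)%R.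
Proof. by rewrite /tail_weight; case: ifP. Qed.

Definition tail_sum (B : (set T)^nat) (K : nat) (w : T) : \bar R :=
  \sum_(n <oo) (tail_weight K n * \1_(B n) w)%:E.

Lemma tail_sum_ge0 B K w : 0 <= tail_sum B K w.
Proof. by apply: nneseries_ge0 => n _ _; rewrite lee_fin mulr_ge0 ?tail_weight_ge0. Qed.

Lemma tail_sum_ge_term B K w n : (K <= n)%N -> B n w ->
  n.+1%:R%:E <= tail_sum B K w.
Proof.
move=> Kn Bn.
apply: le_trans (nneseries_lim_ge n.+1 _); last first.
  by move=> k _ _; rewrite lee_fin mulr_ge0 ?tail_weight_ge0.
rewrite big_nat_recr//= indicE mem_set// mulr1 {2}/tail_weight Kn.
rewrite leeDr// sume_ge0// => k _.
by rewrite lee_fin mulr_ge0 ?tail_weight_ge0.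
Qed.

(* If the least admissible [k] exceeds [K + 1], then index [k - 1] is bad and
   contributes exactly [k] to the sum; if there is no admissible [k], bad
   indices occur arbitrarily late and the sum is infinite. *)
Lemma ereal_inf_le_tail_sum (G : nat -> Prop) (B : (set T)^nat) (K : nat) (w : T) :
  (forall n, (1 <= n)%N -> G n \/ B n w) ->
  ereal_inf [set (k%:R)%:E | k in [set k : nat | (1 <= k)%N /\
     forall n : nat, (k <= n)%N -> G n]] <= K.+1%:R%:E + tail_sum B K w.
Proof.
move=> GB.
pose p k := (0 < k)%N && `[< forall n : nat, (k <= n)%N -> G n >].
have np k : (0 < k)%N -> ~~ p k -> exists2 n, (k <= n)%N & ~ G n.
  move=> k0; rewrite /p k0/= => /asboolPn/existsNP[n].
  by move=> /not_implyP[kn nG]; exists n.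
have [ex|nex] := pselect (exists k, p k).
  case: (ex_minnP ex) => k /andP[k0 /asboolP kG] kmin.
  apply: (@le_trans _ _ k%:R%:E); first by apply: ereal_inf_lbound; exists k.
  have [kK|Kk] := leqP k K.+1.
    by rewrite -[leLHS]adde0 leeD ?lee_fin ?ler_nat// tail_sum_ge0.
  have k1 : (0 < k.-1)%N by rewrite -ltnS prednK// (leq_trans _ Kk).
  have [|n kn nG] := np k.-1 k1.
    by apply/negP => /kmin; rewrite leqNgt ltn_predL k0.
  have nk : n = k.-1.
    apply/eqP; rewrite eqn_leq kn andbT -ltnS prednK// ltnNge.
    by apply/negP => /kG.
  rewrite -[leLHS]add0e leeD ?lee_fin// -(prednK k0).
  apply: tail_sum_ge_term; first by rewrite -ltnS prednK// ltnW.
  by rewrite -nk; case: (GB n) => //; rewrite nk.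
suff -> : tail_sum B K w = +oo by rewrite addey ?leey.
apply: eq_infty => r.
pose N := (K + (Num.truncn r).+1)%N.
have pN : ~~ p N by apply/negP => pN; apply: nex; exists N.
have [|n Nn nG] := np N _ pN; first by rewrite /N addnS.
have n0 : (0 < n)%N by apply: leq_trans Nn; rewrite /N addnS.
apply: (@le_trans _ _ n.+1%:R%:E).
  rewrite lee_fin (le_trans (ltW (truncnS_gt _)))// ler_nat.
  by apply: leq_trans (leqnSn _); apply: leq_trans Nn; exact: leq_addl.
apply: tail_sum_ge_term; first by apply: leq_trans Nn; exact: leq_addr.
by have [] := GB _ n0.
Qed.

Lemma measurable_tail_sum (B : (set T)^nat) K :
  (forall n, measurable (B n)) -> measurable_fun setT (tail_sum B K).
Proof.
move=> mB; apply: ge0_emeasurable_sum.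
  by move=> n w _ _; rewrite lee_fin mulr_ge0 ?tail_weight_ge0.
by move=> n _; apply/measurable_EFinP; exact: measurable_funM.
Qed.

(** The function [F] acts as a discrete antiderivative: the weighted probabilities telescope, so no
    series has to be summed. *)
Lemma integral_tail_sum_le (B : (set T)^nat) (K : nat) (p F : nat -> R) :
  (forall n, measurable (B n)) ->
  (forall n, (K <= n)%N -> P (B n) <= (p n)%:E) ->
  (forall n, (K <= n)%N -> n.+1%:R * p n <= F n - F n.+1)%R ->
  (forall n, (K <= n)%N -> 0 <= F n)%R ->
  \int[P]_w tail_sum B K w <= (F K)%:E.
Proof.
move=> mB Bp pF F0.
rewrite nneseries_integral_indicM//; last by move=> n; exact: tail_weight_ge0.
(* The index [maxn n K] makes the bound read 0 while [n] is below the cutoff, where all weights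
   vanish. *)
have partial n : \sum_(0 <= i < n) (tail_weight K i)%:E * P (B i) <=
    (F K - F (maxn n K))%:E.
  elim: n => [|n IH]; first by rewrite big_nil max0n subrr.
  rewrite big_nat_recr//=; have [Kn|nK] := leqP K n.
    rewrite (maxn_idPl (leqW Kn)); rewrite (maxn_idPl Kn) in IH.
    apply: (@le_trans _ _ ((F K - F n)%:E + (F n - F n.+1)%:E)); last first.
      by rewrite -EFinD lee_fin; lra.
    apply: leeD => //; apply: (@le_trans _ _ (n.+1%:R%:E * (p n)%:E)).
      by rewrite /tail_weight Kn; apply: lee_wpmul2l; rewrite ?lee_fin// Bp.
    by rewrite -EFinM lee_fin pF.
  rewrite /tail_weight leqNgt nK/= mul0e adde0 (maxn_idPr nK).
  by rewrite (maxn_idPr (ltnW nK)) in IH.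
apply: lime_le.
  by apply: is_cvg_nneseries => n _ _; rewrite mule_ge0// lee_fin tail_weight_ge0.
apply: nearW => n; apply: le_trans (partial n) _.
by rewrite lee_fin lerBlDr lerDl F0// leq_maxr.
Qed.

End last_exceedance.

(** * Telescoping majorants and choice of the cutoff *)

Section series_majorants.
Context (R : realType).
Implicit Types (x y a b r s q theta M : R).

(** Discrete counterpart of the derivative of [- x^(-a)], used to telescope sums of [n^(-a-1)]. It
    combines [ln (x + 1) - ln x >= 1 / (x + 1)] with [expR (- u) <= 1 / (1 + u)]; the constant comes
    from [x + 1 + a <= (2 + a) x]. *)
Lemma powRN_sub_ge a x : 0 < a -> 1 <= x ->
  a / (2 + a) * x `^ (- a - 1) <= x `^ (- a) - (x + 1) `^ (- a).
Proof.
move=> a0 x1; have x0 : 0 < x by lra.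
have x10 : 0 < x + 1 by lra.
rewrite powRB; last by rewrite (gt_eqF x0) implybT.
rewrite powRr1 ?(ltW x0)//.
have lnx : (x + 1)^-1 <= ln (x + 1) - ln x.
  have xx : x = (x + 1) * (1 + - (x + 1)^-1) by field; lra.
  have i1 : (x + 1)^-1 < 1 by rewrite invf_lt1//; lra.
  have : ln (1 + - (x + 1)^-1) <= - (x + 1)^-1 by apply: le_ln1Dx; lra.
  have : ln x = ln (x + 1) + ln (1 + - (x + 1)^-1).
    by rewrite -lnM ?posrE//; [congr ln|lra].
  lra.
have -> : (x + 1) `^ (- a) = x `^ (- a) * expR (- (a * (ln (x + 1) - ln x))).
  rewrite /powR !gt_eqF// -expRD; congr expR; ring.
have xa0 : 0 <= x `^ (- a) by exact: powR_ge0.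
have e1 : expR (- (a * (ln (x + 1) - ln x))) <= (1 + a / (x + 1))^-1.
  rewrite expRN lef_pV2 ?posrE ?expR_gt0//; last first.
    by rewrite addr_gt0// divr_gt0.
  apply: le_trans (expR_ge1Dx _); rewrite lerD2l.
  by rewrite ler_pM2l.
have e2 : a / (2 + a) / x <= 1 - (1 + a / (x + 1))^-1.
  have -> : 1 - (1 + a / (x + 1))^-1 = a / (x + 1 + a) by field; lra.
  rewrite -mulrA -invfM ler_pM2l// lef_pV2 ?posrE; nra.
have -> : a / (2 + a) * (x `^ (- a) / x) = x `^ (- a) * (a / (2 + a) / x) by ring.
have : x `^ (- a) * expR (- (a * (ln (x + 1) - ln x))) <=
  x `^ (- a) * (1 + a / (x + 1))^-1 by rewrite ler_wpM2l.
have : x `^ (- a) * (a / (2 + a) / x) <= x `^ (- a) * (1 - (1 + a / (x + 1))^-1).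
  by rewrite ler_wpM2l.
lra.
Qed.

(** For [0 <= r < 1] this is the closed form of the sum of [(k + 1) r^k] over [k >= n]. *)
Definition geometric_tail r (n : nat) : R :=
  r ^+ n * (n.+1%:R / (1 - r) + r / (1 - r) ^+ 2).

Lemma geometric_tail_sub r n : r < 1 ->
  geometric_tail r n - geometric_tail r n.+1 = n.+1%:R * r ^+ n.
Proof.
move=> r1; have r10 : 1 - r != 0 by rewrite subr_eq0 gt_eqF.
rewrite /geometric_tail [r ^+ n.+1]exprS -[n.+2%:R]natr1.
move: (r ^+ n) (n.+1%:R) => z k; field; exact: r10.
Qed.

Lemma geometric_tail_ge0 r n : 0 <= r < 1 -> 0 <= geometric_tail r n.
Proof.
move=> /andP[r0 r1]; rewrite mulr_ge0 ?exprn_ge0// addr_ge0// divr_ge0//.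
  by rewrite subr_ge0 ltW.
by rewrite sqr_ge0.
Qed.

Lemma truncnS_bounds x : 0 <= x -> x <= (Num.truncn x).+1%:R <= x + 1.
Proof.
by move=> x0; rewrite (ltW (truncnS_gt x))/= -natr1 lerD2r truncn_le.
Qed.

Lemma powR_ge1 x y : 1 <= x -> 0 <= y -> 1 <= x `^ y.
Proof.
move=> x1 y0; have <- : 1 `^ y = 1 :> R by rewrite powR1.
by rewrite ge0_ler_powR ?nnegrE ?(le_trans ler01 x1).
Qed.

(** From [ln (1 / s) <= 1 / s - 1] follows [s ln s >= s - 1]. It lets additive constants be absorbed
    into the rate, which vanishes at [s = 1]. *)
Lemma mul_ln_ge1 (s : nat) : (2 <= s)%N -> 1 <= s%:R * ln s%:R :> R.
Proof.
move=> s2; have sR2 : (2 : R) <= s%:R by rewrite ler_nat.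
have sR0 : (0 : R) < s%:R by lra.
have sV0 : (0 : R) < s%:R^-1 by rewrite invr_gt0.
have : ln (1 + (s%:R^-1 - 1)) <= s%:R^-1 - 1 :> R by apply: le_ln1Dx; lra.
rewrite addrC subrK lnV ?posrE// => H.
have : s%:R * (1 - s%:R^-1) <= s%:R * ln s%:R :> R by rewrite ler_pM2l//; lra.
by rewrite mulrBr divff ?gt_eqF//; lra.
Qed.

(** The summand is of order [s^q n^(1-q)], so the tail from [K] is of order [s^q K^(2-q)]. Equating
    this with [K] gives [K] of order [s^(q/(q-1))]. *)
Lemma polynomial_tail_bound b q M : 0 < b -> 2 < q -> 0 <= M ->
  exists C : R, forall s : nat, (1 <= s)%N ->
    exists (K : nat) (F : nat -> R),
    [/\ (0 < K)%N,
        forall n, (K <= n)%N ->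
          n.+1%:R * (M * (n%:R * b / s%:R) `^ (- q)) <= F n - F n.+1,
        forall n, 0 <= F n & K.+1%:R + F K <= C * s%:R `^ (q / (q - 1))].
Proof.
move=> b0 q2 M0.
pose a := q - 2; have a0 : 0 < a by rewrite /a; lra.
(* The 2 comes from [n + 1 <= 2 n]; the last factor inverts the constant of [powRN_sub_ge]. *)
pose D := 2 * M * b `^ (- q) * ((2 + a) / a).
have D0 : 0 <= D.
  by rewrite /D !mulr_ge0 ?powR_ge0 ?invr_ge0 ?(ltW a0)//; lra.
(* The 3 covers [K.+1 <= sg + 2 <= 3 * sg], and [D] covers [F K]. *)
exists (3 + D) => s s1.
have sR0 : (0 : R) < s%:R by rewrite ltr0n.
have sR1 : (1 : R) <= s%:R by rewrite ler1n.
pose sg : R := s%:R `^ (q / (q - 1)).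
have sg1 : 1 <= sg by apply: powR_ge1 => //; rewrite divr_ge0; lra.
pose K := (Num.truncn sg).+1.
pose F (n : nat) := D * s%:R `^ q * n%:R `^ (- a).
exists K, F; split => //.
- move=> n Kn; have n1 : (1 : R) <= n%:R.
    by rewrite ler1n; apply: leq_trans Kn.
  have n0 : (0 : R) < n%:R by lra.
  have -> : (n%:R * b / s%:R) `^ (- q) = n%:R `^ (- q) * b `^ (- q) * s%:R `^ q.
    rewrite !powRM ?invr_ge0 ?mulr_ge0 ?(ltW n0) ?(ltW b0) ?(ltW sR0)//.
    by congr (_ * _); rewrite -powR_inv1 ?(ltW sR0)// -powRrM; congr (_ `^ _); ring.
  have := powRN_sub_ge a0 n1.
  have nq : n%:R `^ (- a - 1) = n%:R * n%:R `^ (- q) :> R.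
    rewrite -{2}(powRr1 (ltW n0)) -powRD; last by rewrite (gt_eqF n0) implybT.
    by congr (_ `^ _); rewrite /a; ring.
  rewrite nq /F natr1 => H.
  have sq0 : 0 <= (s%:R : R) `^ q by exact: powR_ge0.
  have nq0 : 0 <= (n%:R : R) `^ (- q) by exact: powR_ge0.
  rewrite -mulrBr.
  apply: (@le_trans _ _ (D * s%:R `^ q * (a / (2 + a) * (n%:R * n%:R `^ (- q))))).
    have -> : D * s%:R `^ q * (a / (2 + a) * (n%:R * n%:R `^ (- q))) =
      (2 * n%:R) * (M * (n%:R `^ (- q) * b `^ (- q) * s%:R `^ q)).
      by rewrite /D; field; apply/andP; split; lra.
    rewrite ler_wpM2r ?mulr_ge0 ?powR_ge0// -natr1; lra.
  apply: ler_wpM2l; first exact: mulr_ge0.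
  exact: H.
- by move=> n; rewrite mulr_ge0 ?powR_ge0// mulr_ge0 ?powR_ge0.
have /andP[sgK Ksg] := truncnS_bounds (le_trans ler01 sg1).
have FK : F K <= D * sg.
  rewrite /F -mulrA ler_wpM2l//.
  apply: (@le_trans _ _ (s%:R `^ q * sg `^ (- a))).
    have sg0 : 0 < sg := lt_le_trans ltr01 sg1.
    rewrite ler_wpM2l ?powR_ge0// !powRN lef_pV2 ?posrE ?powR_gt0//.
    by rewrite ge0_ler_powR ?nnegrE ?(ltW a0) ?(ltW sg0).
  rewrite /sg -powRrM -powRD; last by rewrite (gt_eqF sR0) implybT.
  suff -> : q + q / (q - 1) * - a = q / (q - 1) by [].
  by rewrite /a; field; lra.
have {}Ksg : K%:R <= sg + 1 := Ksg.
rewrite -[K.+1%:R]natr1 -/sg mulrDl; lra.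
Qed.

(** The summands are [M (n + 1) r^n] with [r = expR (- theta b / s)], so [geometric_tail] telescopes
    them exactly. Its factors [1 / (1 - r)] are of order [s], and the cutoff makes [r^K] small
    enough to cancel their square. *)
Lemma exponential_tail_bound b theta M : 0 < b -> 0 < theta -> 0 <= M ->
  exists C : R, forall s : nat, (2 <= s)%N ->
    exists (K : nat) (F : nat -> R),
    [/\ (0 < K)%N,
        forall n, (K <= n)%N ->
          n.+1%:R * (M * expR (- (theta * (n%:R * b / s%:R)))) <= F n - F n.+1,
        forall n, 0 <= F n & K.+1%:R + F K <= C * (s%:R * ln s%:R)].
Proof.
move=> b0 t0 M0.
have tb0 : 0 < theta * b by exact: mulr_gt0.
(* Here [s * A] will bound [1 / (1 - r)], and [B * L] will bound [K.+1], the summand 2 in [B] paying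
   for rounding since [L >= 1]. *)
pose A := 1 + (theta * b)^-1.
pose B := 2 / (theta * b) + 2.
have tbV0 : 0 < (theta * b)^-1 by rewrite invr_gt0.
have A0 : 0 < A by rewrite /A; lra.
have B0 : 0 < B by rewrite /B; lra.
exists (B + M * (B * A + A ^+ 2)) => s s2.
have sR2 : (2 : R) <= s%:R by rewrite ler_nat.
have sR0 : (0 : R) < s%:R by lra.
pose L : R := s%:R * ln s%:R.
have L1 : 1 <= L by exact: mul_ln_ge1.
pose y := theta * b / s%:R.
have y0 : 0 < y by rewrite divr_gt0.
pose r := expR (- y).
have r1 : r < 1 by rewrite -expR0 ltr_expR; lra.
have r0 : 0 <= r by exact: expR_ge0.
(* The factor 2 is what yields [r^K <= s^(-2)]. *)
pose K := (Num.truncn (2 / (theta * b) * L)).+1.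
pose F n := M * geometric_tail r n.
have rn n : expR (- (theta * (n%:R * b / s%:R))) = r ^+ n.
  by rewrite /r -expRM_natl; congr expR; rewrite /y; ring.
exists K, F; split => //.
- move=> n _; rewrite /F -mulrBr geometric_tail_sub// rn mulrCA; lra.
- by move=> n; rewrite /F mulr_ge0// geometric_tail_ge0// r0.
have /andP[LK KL] := @truncnS_bounds (2 / (theta * b) * L)
  (mulr_ge0 (mulr_ge0 (ler0n _ _) (ltW tbV0)) (le_trans ler01 L1)).
have K1 : K.+1%:R <= B * L.
  have {}KL : K%:R <= 2 / (theta * b) * L + 1 := KL.
  rewrite -[K.+1%:R]natr1 /B mulrDl; lra.
have r1V : (1 - r)^-1 <= s%:R * A.
  (* This gives [1 / (1 - r) <= 1 + 1 / y = 1 + s / (theta b)]. *)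
  have ry : r <= (1 + y)^-1.
    by rewrite /r expRN lef_pV2 ?posrE ?expR_gt0 ?expR_ge1Dx//; lra.
  apply: (@le_trans _ _ (1 + y^-1)).
    have -> : 1 + y^-1 = (1 - (1 + y)^-1)^-1 by field; lra.
    rewrite lef_pV2 ?posrE; [lra|lra|].
    by rewrite subr_gt0 invf_lt1; lra.
  rewrite /A /y invf_div mulrDr mulr1; lra.
have r1V0 : 0 <= (1 - r)^-1 by rewrite invr_ge0; lra.
have rK : r ^+ K <= (s%:R ^+ 2)^-1.
  rewrite -rn -[s%:R in leRHS]lnK ?posrE// -expRM_natl -expRN ler_expR lerN2.
  have -> : theta * (K%:R * b / s%:R) = (theta * b / s%:R) * K%:R by ring.
  have -> : 2%:R * ln (s%:R : R) = (theta * b / s%:R) * (2 / (theta * b) * L).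
    by rewrite /L; field; lra.
  by rewrite ler_wpM2l// ltW.
have FK : geometric_tail r K <= B * L * A + A ^+ 2.
  apply: (@le_trans _ _ ((s%:R ^+ 2)^-1 * (B * L * (s%:R * A) + (s%:R * A) ^+ 2))).
    rewrite /geometric_tail ler_pM ?exprn_ge0//.
      by rewrite addr_ge0 ?divr_ge0 ?sqr_ge0// subr_ge0 ltW.
    apply: lerD.
      by rewrite ler_pM.
    rewrite -exprVn -[leRHS]mul1r ler_pM ?exprn_ge0 ?(ltW r1)//.
    by rewrite lerXn2r ?nnegrE// mulr_ge0 ?(ltW A0).
  have -> : (s%:R ^+ 2)^-1 * (B * L * (s%:R * A) + (s%:R * A) ^+ 2) =
    B * L * A / s%:R + A ^+ 2.
    by move: sR0; clear; clearbody A B L; move: s%:R => z z0; field; rewrite gt_eqF.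
  have BLA0 : 0 <= B * L * A.
    exact: mulr_ge0 (mulr_ge0 (ltW B0) (le_trans ler01 L1)) (ltW A0).
  have s1 : (1 : R) <= s%:R by apply: le_trans sR2; rewrite ler1n.
  by rewrite lerD2r ler_pdivrMr// ler_peMr.
have : M * geometric_tail r K <= M * (B * L * A + A ^+ 2) by rewrite ler_wpM2l.
have : M * (B * L * A + A ^+ 2) <= M * (B * A + A ^+ 2) * L.
  rewrite -[leRHS]mulrA ler_wpM2l// [leRHS]mulrDl [B * A * L]mulrAC lerD2l.
  by rewrite ler_peMr// sqr_ge0.
by move=> MF2 MF1; rewrite -/L /F mulrDl; apply: lerD K1 (le_trans MF1 MF2).
Qed.

End series_majorants.

(** * Expectation of [kappa]: service and arrival contributions *)

Section kappa_bound.
Context d (T : measurableType d) (R : realType) (P : probability T R).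
Variables (X V : nat -> T -> R) (U : T -> R) (mu eps : R).
Local Open Scope ereal_scope.

Definition service_exceeds (s n : nat) : set T :=
  [set w | (n%:R * (mu - eps) / s%:R < V n w)%R].

(* The scale [s] cancels in [kappaA], so this event does not depend on it. *)
Definition arrival_lags (n : nat) : set T :=
  [set w | (U w + \sum_(i < n) X i w < n%:R * (mu - eps))%R].

Hypothesis mX : forall n, measurable_fun setT (X n).
Hypothesis mV : forall n, measurable_fun setT (V n).
Hypothesis mU : measurable_fun setT U.

Lemma measurable_service_exceeds s n : measurable (service_exceeds s n).
Proof.
rewrite -[service_exceeds s n]setTI.
exact: (measurable_fun_ltr (measurable_cst _) (mV n)).
Qed.

Lemma measurable_arrival_lags n : measurable (arrival_lags n).
Proof.
rewrite -[arrival_lags n]setTI.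
apply: measurable_fun_ltr => //.
by apply: measurable_funD => //; apply: measurable_sum.
Qed.

Lemma kappaV_le_tail_sum s K w :
  kappaV mu eps s V w <= K.+1%:R%:E + tail_sum R (service_exceeds s) K w.
Proof.
apply: ereal_inf_le_tail_sum => n _.
by have [|] := lerP (V n w) (n%:R * (mu - eps) / s%:R)%R; [left|right].
Qed.

(** The distance of the arrival epoch from 0 is at least [(U + S_n) / s], whatever the sign of [U],
    so an index violating the condition in [kappaA] lies in [arrival_lags]. *)
Lemma kappaA_le_tail_sum s K w : (0 < s)%N ->
  kappaA mu eps s U X w <= K.+1%:R%:E + tail_sum R arrival_lags K w.
Proof.
move=> s0; apply: ereal_inf_le_tail_sum => n _.
have [le|lt] := lerP (n%:R * (mu - eps))%R (U w + \sum_(i < n) X i w)%R.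
  left; rewrite /arrival normrN; apply: le_trans (ler_norm _).
  by rewrite ler_wpM2r// invr_ge0.
by right.
Qed.

Lemma ereal_inf_natr_ge0 (A : set nat) :
  0 <= ereal_inf [set ((k%:R)%:E : \bar R) | k in A].
Proof. by apply: le_ereal_inf_tmp => _ [k _ <-]; rewrite lee_fin. Qed.

(** The maximum is at most the sum of its two terms. The cutoff [K] serves the services only; the
    arrivals use cutoff 0. *)
Lemma integral_kappa_le s K : (0 < s)%N ->
  \int[P]_w kappa mu eps s U X V w <=
  (K.+1%:R%:E + \int[P]_w tail_sum R (service_exceeds s) K w) +
  (1 + \int[P]_w tail_sum R arrival_lags 0 w).
Proof.
move=> s0.
have mS := measurable_tail_sum K (measurable_service_exceeds s).
have mA := measurable_tail_sum 0 measurable_arrival_lags.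
have cst_int (c : R) (f : T -> \bar R) : (0 <= c)%R -> measurable_fun setT f ->
    (forall w, 0 <= f w) ->
    c%:E + \int[P]_w f w = \int[P]_w (c%:E + f w).
  move=> c0 mf f0; rewrite ge0_integralD//.
  by rewrite (integral_cst P measurableT c%:E) [X in _ * X]probability_setT mule1.
rewrite !cst_int//; try by move=> w; exact: tail_sum_ge0.
rewrite -ge0_integralD//; last 4 first.
- by move=> w _; rewrite adde_ge0 ?lee_fin ?tail_sum_ge0.
- exact: emeasurable_funD.
- by move=> w _; rewrite adde_ge0 ?lee_fin ?tail_sum_ge0.
- exact: emeasurable_funD.
(* Pointwise domination suffices here, so measurability of [kappa] itself is never established. *)
apply: ge0_le_integral_sup => w.
  by rewrite /kappa le_max ereal_inf_natr_ge0.
rewrite /kappa ge_max; apply/andP; split.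
  apply: le_trans (kappaV_le_tail_sum s K w) _.
  by rewrite leeDl// adde_ge0 ?lee_fin ?tail_sum_ge0.
apply: le_trans (kappaA_le_tail_sum 0 w s0) _.
by rewrite leeDr// adde_ge0 ?lee_fin ?tail_sum_ge0.
Qed.

Hypothesis X_gt0 : forall n w, (0 < X n w)%R.
Hypothesis idX : identically_distributed P X.
Hypothesis indX : mutually_independent P X.
Hypothesis EX : \int[P]_w (X 0%N w)%:E = mu%:E.
Hypothesis excess : stationary_excess P mu (X 0%N) U.
Hypothesis eps_mu : (0 < eps < mu)%R.

(** At [x = 0] the excess identity integrates over a Lebesgue-null singleton, and [mu] is nonzero.
    This supplies the almost sure positivity of [U]. *)
Lemma stationary_excess_le0 : P [set w | (U w <= 0)%R] = 0.
Proof.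
have := excess (lexx 0%R); rewrite set_itv1 integral_set1 => /eqP.
rewrite mule_eq0 eqe => /orP[/eqP mu0|/eqP//].
by move: eps_mu; rewrite mu0 => /andP[e0]; rewrite ltNge ltW.
Qed.

(** Outside the null event [U <= 0], lagging forces [S_n < n (mu - eps)]; independence turns the
    Chernoff bound for that event into the power of a single factor [rho]. *)
Lemma probability_arrival_lags_le :
  exists2 rho : R, (0 <= rho < 1)%R &
    forall n, P (arrival_lags n) <= (rho ^+ n)%:E.
Proof.
have [t [rho [t0 rho01 mgf]]] : exists t rho : R, [/\ (0 < t)%R, (0 <= rho < 1)%R &
    \int[P]_w (expR (t * (mu - eps - X 0%N w)))%:E = rho%:E].
  apply: lower_mgf_lt1 => //; first by move=> w; exact: ltW.
  by rewrite EX lte_fin; case/andP: eps_mu => e0 _; rewrite ltrBlDr ltrDl.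
pose g x := expR (t * (mu - eps - x)).
have mg : measurable_fun setT g.
  apply: measurableT_comp => //; apply: measurable_funM => //.
  exact: measurable_funB.
have g0 x : (0 <= g x)%R by exact: expR_ge0.
have Eg n : \int[P]_w (g (X n w))%:E = rho%:E.
  by rewrite (identically_distributed_integral n mX idX mg g0).
exists rho => // n.
have mS : measurable_fun setT (fun w => \sum_(i < n) X i w)%R.
  by apply: measurable_sum.
pose S : set T := [set w | (\sum_(i < n) X i w < n%:R * (mu - eps))%R].
have mSn : measurable S.
  by rewrite -[S]setTI; apply: measurable_fun_ltr.
have mU0 : measurable [set w | (U w <= 0)%R].
  by rewrite -[[set _ | _]]setTI; apply: measurable_fun_ler.
have : P (arrival_lags n) <= P (S `|` [set w | (U w <= 0)%R]).
  apply: le_measure.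
  - by apply/mem_set; exact: measurable_arrival_lags.
  - by apply/mem_set; exact: measurableU.
  move=> w; rewrite /arrival_lags /S /= => lt.
  by have [|U0] := lerP (U w) 0; [right|left; apply: le_lt_trans lt; rewrite lerDr ltW].
move/le_trans; apply; apply: le_trans (measureU2 _ mSn mU0) _.
rewrite [X in _ + X]stationary_excess_le0 adde0.
apply: le_trans (@measure_le_integral _ _ _ P S
  (fun w => \prod_(i < n) g (X i w))%R mSn _ _ _) _.
- by apply: measurable_prod => i _; exact: measurableT_comp.
- by move=> w; exact: prodr_ge0.
(* On [S] the total exponent [t (n (mu - eps) - S_n)] is nonnegative, so the product is at least
   1. *)
- move=> w Sw; rewrite /g -expR_sum -mulr_sumr sumrB sumr_const card_ord.
  apply: le_trans (expR_ge1Dx _); rewrite lerDl mulr_ge0 ?(ltW t0)//.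
  by rewrite subr_ge0 -mulr_natl ltW.
rewrite expectation_prod//; last by move=> k; rewrite Eg.
under eq_bigr do rewrite Eg.
by rewrite prodEFin lee_fin prodr_const card_ord.
Qed.

Lemma integral_arrival_lags_fin :
  exists C : R, \int[P]_w tail_sum R arrival_lags 0 w <= C%:E.
Proof.
have [rho rho01 rhoP] := probability_arrival_lags_le.
exists (geometric_tail rho 0); apply: integral_tail_sum_le.
- exact: measurable_arrival_lags.
- by move=> n _; exact: rhoP.
- by move=> n _; rewrite geometric_tail_sub//; case/andP: rho01.
- by move=> n _; exact: geometric_tail_ge0.
Qed.

(** Common end of both claims, which differ only in the service tail [p] and the rate. The bound [p]
    is asked from [n = 1] on because the threshold is 0 at [n = 0]; [0 < K] keeps that index out of
    the sum. *)
Lemma integral_kappa_rate (s0 : nat) (rate : nat -> R) (p : nat -> nat -> R) :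
  (forall s, (s0 <= s)%N -> (1 <= s)%N -> (1 <= rate s)%R) ->
  (forall s n, (1 <= s)%N -> (1 <= n)%N -> P (service_exceeds s n) <= (p s n)%:E) ->
  (exists C : R, forall s, (s0 <= s)%N -> (1 <= s)%N ->
    exists (K : nat) (F : nat -> R),
    [/\ (0 < K)%N,
        forall n, (K <= n)%N -> (n.+1%:R * p s n <= F n - F n.+1)%R,
        forall n, (0 <= F n)%R & (K.+1%:R + F K <= C * rate s)%R]) ->
  exists C : R, exists s0 : nat, forall s : nat, (s0 <= s)%N -> (1 <= s)%N ->
    \int[P]_w kappa mu eps s U X V w <= (C * rate s)%:E.
Proof.
move=> rate1 pP [C CP]; have [CA CAP] := integral_arrival_lags_fin.
(* The arrival contribution is bounded uniformly in [s], hence absorbed by a rate that is at least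
   1. *)
exists (C + (1 + `|CA|))%R, s0 => s s0s s1.
have [K [F [K0 pF F0 KF]]] := CP s s0s s1.
apply: le_trans (integral_kappa_le K s1) _.
rewrite mulrDl EFinD leeD//.
  apply: (@le_trans _ _ (K.+1%:R%:E + (F K)%:E)); last by rewrite -EFinD lee_fin.
  rewrite leeD2l//; apply: (integral_tail_sum_le (p := p s)) => //.
  - exact: measurable_service_exceeds.
  - by move=> n Kn; apply: pP => //; exact: leq_trans Kn.
apply: (@le_trans _ _ (1 + `|CA|)%:E).
  by rewrite EFinD leeD2l// (le_trans CAP)// lee_fin ler_norm.
by rewrite lee_fin ler_peMr ?rate1// addr_ge0.
Qed.

End kappa_bound.

(** * Markov's inequality for service times and final assembly *)

(** The factor [a] stands for [1 / phi c]; it is later [c^(-q)] or [expR (- theta c)]. *)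
Lemma markov_identically_distributed d (T : measurableType d) (R : realType)
    (P : probability T R) (V : nat -> T -> R) (phi : R -> R) (M a c : R) (n : nat) :
  (forall n, measurable_fun setT (V n)) -> identically_distributed P V ->
  measurable_fun setT phi -> (forall x, 0 <= phi x) ->
  (\int[P]_w (phi (V 0%N w))%:E = M%:E)%E -> 0 <= a ->
  (forall x, c < x -> 1 <= a * phi x) ->
  (P [set w | (c < V n w)%R] <= (M * a)%:E)%E.
Proof.
move=> mV idV mphi phi0 EM a0 aphi.
have mE : measurable [set w | c < V n w].
  by rewrite -[[set _ | _]]setTI; apply: measurable_fun_ltr.
have mphiV : measurable_fun setT (phi \o V n) by exact: measurableT_comp.
apply: le_trans (@measure_le_integral _ _ _ P _ (fun w => a * phi (V n w)) mE _ _ _) _.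
- exact: measurable_funM.
- by move=> w; exact: mulr_ge0.
- by move=> w /=; exact: aphi.
under eq_integral do rewrite EFinM.
have phiVE : measurable_fun setT (fun w => (phi (V n w))%:E).
  exact/measurable_EFinP.
rewrite ge0_integralZl//; last by move=> w _; rewrite lee_fin.
rewrite (identically_distributed_integral n mV idV mphi phi0) EM -EFinM.
by rewrite mulrC.
Qed.

Lemma ge0_integral_ltyP d (T : measurableType d) (R : realType)
    (P : {measure set T -> \bar R}) (f : T -> R) :
  (forall w, 0 <= f w) -> (\int[P]_w (f w)%:E < +oo)%E ->
  exists2 M : R, 0 <= M & (\int[P]_w (f w)%:E = M%:E)%E.
Proof.
move=> f0 foo.
have I0 : (0 <= \int[P]_w (f w)%:E)%E by apply: integral_ge0 => w _; rewrite lee_fin.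
exists (fine (\int[P]_w (f w)%:E)); first exact: fine_ge0.
by rewrite fineK// ge0_fin_numE.
Qed.

(** Independence restricts along the injection of interarrival indices into [rv_index]. *)
Lemma mutually_independent_interarrival d (T : measurableType d) (R : realType)
    (P : probability T R) (X V : nat -> T -> R) (U : T -> R) :
  mutually_independent P
    (fun i : rv_index => match i with
                         | inl (inl n) => X n
                         | inl (inr n) => V n
                         | inr _ => U end) ->
  mutually_independent P X.
Proof.
move=> ind J B uJ mB.
pose e (n : nat) : rv_index := inl (inl n).
have eI : injective e by move=> m n [].
pose B' (i : rv_index) := if i is inl (inl n) then B n else setT.
have := ind (map e J) B'; rewrite !big_map; apply.
  by rewrite map_inj_uniq.
by move=> _ /mapP[n nJ ->]; exact: mB.
Qed.

Theorem theorem1 (R : realType) (d : measure_display) (T : measurableType d)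
  (P : probability T R) (X V : nat -> T -> R) (U : T -> R) (mu eps : R) :
  (forall n, measurable_fun setT (X n)) ->
  (forall n, measurable_fun setT (V n)) ->
  measurable_fun setT U ->
  (forall n w, 0 < X n w) ->
  (forall n w, 0 <= V n w) ->
  identically_distributed P X ->
  identically_distributed P V ->
  mutually_independent P
    (fun i : rv_index => match i with
                         | inl (inl n) => X n
                         | inl (inr n) => V n
                         | inr _ => U end) ->
  (\int[P]_w (X 0%N w)%:E = mu%:E)%E ->
  stationary_excess P mu (X 0%N) U ->
  0 < eps < mu ->
  (forall q : R, 2 < q ->
     (\int[P]_w ((V 0%N w) `^ q)%:E < +oo)%E ->
     exists C : R, exists s0 : nat, forall s : nat, (s0 <= s)%N -> (1 <= s)%N ->
       (\int[P]_w kappa mu eps s U X V w <= (C * s%:R `^ (q / (q - 1)))%:E)%E)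
  /\
  (forall q theta : R, 2 < q -> 0 < theta ->
     (\int[P]_w ((V 0%N w) `^ q)%:E < +oo)%E ->
     (\int[P]_w (expR (theta * V 0%N w))%:E < +oo)%E ->
     exists C : R, exists s0 : nat, forall s : nat, (s0 <= s)%N -> (1 <= s)%N ->
       (\int[P]_w kappa mu eps s U X V w <= (C * (s%:R * ln s%:R))%:E)%E).
Proof.
move=> mX mV mU X0 V0 idX idV ind EX excess eps_mu.
have indX := mutually_independent_interarrival ind.
have b0 : 0 < mu - eps by case/andP: eps_mu => _; rewrite subr_gt0.
have c0 (s n : nat) : (1 <= s)%N -> (1 <= n)%N -> 0 < n%:R * (mu - eps) / s%:R.
  by move=> s1 n1; rewrite divr_gt0 ?mulr_gt0 ?ltr0n.
split=> [q q2 /ge0_integral_ltyP[|M M0 EM]|q theta q2 t0 _ /ge0_integral_ltyP[|M M0 EM]].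
- by move=> w; exact: powR_ge0.
- have [q0 q10] : 0 <= q /\ 0 <= q - 1 by move: q2; clear=> q2; lra.
  apply: (integral_kappa_rate mX mV mU X0 idX indX EX excess eps_mu
    (s0 := 1) (rate := fun s => s%:R `^ (q / (q - 1)))
    (p := fun s n => M * (n%:R * (mu - eps) / s%:R) `^ (- q))).
  + by move=> s s1 _; apply: powR_ge1; rewrite ?ler1n ?divr_ge0.
  + move=> s n s1 n1; have c1 := c0 s n s1 n1.
    apply: (markov_identically_distributed (phi := fun x => x `^ q)) => //.
    * by move=> x; exact: powR_ge0.
    * exact: powR_ge0.
    (* The threshold is positive because [n >= 1], so dividing by its power is legitimate and
       monotonicity of the power concludes. *)
    * move=> x cx; rewrite powRN mulrC ler_pdivlMr ?powR_gt0// mul1r.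
      by rewrite ge0_ler_powR ?nnegrE ?(ltW cx) ?(ltW c1) ?(ltW (lt_trans c1 cx)).
  + have [C CP] := polynomial_tail_bound b0 q2 M0.
    by exists C => s _; exact: CP.
- by move=> w; exact: expR_ge0.
(* The claim starts at [s = 2], where [s ln s] first reaches 1. *)
- apply: (integral_kappa_rate mX mV mU X0 idX indX EX excess eps_mu
    (s0 := 2) (rate := fun s => s%:R * ln s%:R)
    (p := fun s n => M * expR (- (theta * (n%:R * (mu - eps) / s%:R))))).
  + by move=> s s2 _; exact: mul_ln_ge1.
  + move=> s n s1 n1.
    apply: (markov_identically_distributed (phi := fun x => expR (theta * x))) => //.
    * by apply: measurableT_comp => //; exact: measurable_funM.
    * move=> x cx; rewrite -expRD -[leLHS]expR0 ler_expR addrC subr_ge0.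
      by rewrite ler_pM2l ?ltW.
  + have [C CP] := exponential_tail_bound b0 t0 M0.
    by exists C => s s2 _; exact: CP.
Qed.
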